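(* For each prime $\ell\ge 3$ let $\mathcal{K}_\ell$ denote the set of positive integers $k\le \ell-2$ for which the Demjanenko matrix $D_{k,\ell}$ is singular. For $x\ge 2$ there are at most $O(x^{3/4}(\log x)^3)$ primes $\ell\equiv 1\pmod 3$ with $\ell\le x$ and $\#\mathcal{K}_\ell=0$; that is, there is an absolute constant $C>0$ such that for all real $x\ge 2$ the number of such primes is at most $C\,x^{3/4}(\log x)^3$.
   Context: For a prime $\ell\ge 3$ and $j\in(\mathbb{Z}/\ell\mathbb{Z})^*$, let $\langle j\rangle_\ell$ be the unique integer representative of $j$ modulo $\ell$ in $\{1,\dots,\ell-1\}$. For a positive integer $k\le \ell-2$ define $$M_{k,\ell}:=\{j\in(\mathbb{Z}/\ell\mathbb{Z})^* : \langle kj\rangle_\ell+\langle j\rangle_\ell<\ell\},$$ a set of cardinality $(\ell-1)/2$, and its stabilizer, the subgroup $$W_{k,\ell}:=\{w\in(\mathbb{Z}/\ell\mathbb{Z})^* : wM_{k,\ell}=M_{k,\ell}\}.$$ For $a\in(\mathbb{Z}/\ell\mathbb{Z})^*$ put $E_{k,\ell}(a):=0$ if $a\in M_{k,\ell}$ and $E_{k,\ell}(a):=1$ if $a\notin M_{k,\ell}$. The Demjanenko matrix is the square rational matrix $$D_{k,\ell}:=\left(E_{k,\ell}(-c^{-1}a)-\tfrac12\right)_{c,a\in M_{k,\ell}/W_{k,\ell}},$$ whose rows and columns are indexed by the $W_{k,\ell}$-orbits in $M_{k,\ell}$ (the entry does not depend on the chosen representatives $c,a$). *)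

(* Defs.v *)
From mathcomp Require Import all_boot all_order all_algebra all_fingroup.

Set Implicit Arguments.
Unset Strict Implicit.
Unset Printing Implicit Defensive.

Import GRing.Theory.

Local Open Scope ring_scope.

(* Throughout, l is meant to be prime, so that 'F_l is Z/lZ and {unit 'F_l} is
   (Z/lZ)^*; the definitions are total but only meaningful in that case. *)

(* <k j>_l : elements of 'F_l are ordinals, coerced to their representative in
   {0, ..., l - 1}; it is nonzero as soon as l does not divide k. *)
Definition residue (l k : nat) (j : {unit 'F_l}) : nat :=
  (k%:R * val j)%R : 'F_l.

Definition Mset (l k : nat) : {set {unit 'F_l}} :=
  [set j | (residue k j + residue 1 j < l)%N].

Definition Wset (l k : nat) : {set {unit 'F_l}} :=
  [set w | (w *: Mset l k)%g == Mset l k].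

Definition Efun (l k : nat) (a : {unit 'F_l}) : rat :=
  if a \in Mset l k then 0 else 1.

Definition unitN1 (l : nat) : {unit 'F_l} := FinRing.unit 'F_l (unitrN1 _).

(* The orbits W a with a in M. *)
Definition orbits (l k : nat) : {set {set {unit 'F_l}}} :=
  rcosets (Wset l k) (Mset l k).

(* Rows and columns are indexed by an enumeration of the orbits; [repr] picks
   a representative of an orbit (see [DemjanenkoE] for the independence of the
   choice). *)
Definition Demjanenko (l k : nat) : 'M[rat]_(#|orbits l k|) :=
  \matrix_(r, s)
    (Efun k (unitN1 l * (repr (enum_val r))^-1 * repr (enum_val s))%g - 1 / 2).

Definition Kset (l : nat) : {set 'I_l} :=
  [set k : 'I_l | (0 < k <= l - 2)%N && (\det (Demjanenko l k) == 0)].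

Lemma Fp_unit_mulgC (l : nat) (u v : {unit 'F_l}) : (u * v = v * u)%g.
Proof. by apply: val_inj; rewrite /= mulrC. Qed.

Lemma Wset_mem (l k : nat) (w a : {unit 'F_l}) :
  w \in Wset l k -> ((w * a)%g \in Mset l k) = (a \in Mset l k).
Proof. by rewrite inE => /eqP {1}<-; rewrite mem_lcoset mulKg. Qed.

Lemma Efun_W (l k : nat) (w a : {unit 'F_l}) :
  w \in Wset l k -> Efun k (w * a)%g = Efun k a.
Proof. by move=> wW; rewrite /Efun Wset_mem. Qed.

Lemma group_set_W (l k : nat) : group_set (Wset l k).
Proof.
apply/group_setP; split=> [|w v]; first by rewrite inE mul1g.
by rewrite !inE => /eqP wM /eqP vM; rewrite -mulg_set1 -mulgA vM wM.
Qed.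
Canonical Wset_group (l k : nat) := group (@group_set_W l k).

Lemma mem_orbit_repr (l k : nat) (O : {set {unit 'F_l}}) (a : {unit 'F_l}) :
  O \in orbits l k -> a \in O -> exists2 w, w \in Wset l k & a = (w * repr O)%g.
Proof.
case/imsetP=> b _ ->; rewrite rcosetE => aWb.
have rWb := mem_repr a aWb; exists (a * (repr (Wset l k :* b)%g)^-1)%g.
  by rewrite -mem_rcoset (@rcoset_eqP _ (Wset_group l k) _ _ rWb).
by rewrite mulgKV.
Qed.

Lemma DemjanenkoE (l k : nat) (r s : 'I_#|orbits l k|) (c a : {unit 'F_l}) :
  c \in enum_val r -> a \in enum_val s ->
  Demjanenko l k r s = Efun k (unitN1 l * c^-1 * a)%g - 1 / 2.
Proof.
move=> /(mem_orbit_repr (enum_valP r))[w wW ->].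
move=> /(mem_orbit_repr (enum_valP s))[v vW ->].
rewrite mxE; congr (_ - _).
set m := unitN1 l; set c' := repr _; set a' := repr (enum_val s).
rewrite -(Efun_W (m * c'^-1 * a')%g vW) -(Efun_W (m * (w * c')^-1 * _)%g wW).
congr Efun; rewrite invMg [(c'^-1 * _)%g]Fp_unit_mulgC !mulgA.
rewrite [(w * m)%g]Fp_unit_mulgC mulgK [(v * m)%g]Fp_unit_mulgC -!mulgA.
by congr (_ * _)%g; rewrite !mulgA [(v * _)%g]Fp_unit_mulgC.
Qed.

(* Main.v *)
Require Import Defs.
From mathcomp Require Import all_boot all_order all_algebra all_fingroup.
From mathcomp Require Import all_classical all_reals all_analysis.
From mathcomp Require Import all_solvable all_field.
From mathcomp Require Import zify ring lra.

Set Implicit Arguments.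
Unset Strict Implicit.
Unset Printing Implicit Defensive.

Import Order.TTheory GRing.Theory Num.Theory.

Local Open Scope ring_scope.

(** Write [W] for the stabilizer and [k' = -(k + 1)].  The sum of the residues
    of [j], [k j], [k' j] is [l] or [2 l] according to whether [j] lies in [M],
    so an odd function [phi] that is constant on the [W]-orbits and satisfies
    [phi j + phi (j / k) + phi (j / k') = 0] gives a kernel vector of the
    Demjanenko matrix.  Let [l - 1 = 2^s 3 h] with [h] odd and let [H] be the
    group of [h]-th roots of unity.  If [k] is in [g H] and [k'] in [g^-1 H],
    where [g^3] but not [g] is in [H], then [psi j - psi (j / k)] is such a
    function, for [psi] the indicator of [H] minus that of [-H], as soon as [W]
    is contained in [H].

    The order of [W] is prime to 6 unless [k^2 + k + 1 = 0]: this is elementary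
    (no nonvanishing of L-functions), see [cube_root_eq].  So if all [D_k] are
    regular, at most two [k] satisfy the coset conditions, whereas a second
    moment computation over the affine maps [x -> u x + v] gives about
    [|H|^2 / l] of them with error at most [sqrt l].  Hence [h^4 <= 16 l^3], that
    is [l <= (12 * 2^s)^4].  For each [s] there are at most [12 x^(3/4)] integers
    [l <= x] with [2^s | l - 1] satisfying this bound, and there are at most
    [log2 x] values of [s]. *)

(** * Sums of residues *)

Ltac gen_ord :=
  repeat match goal with |- context [nat_of_ord ?x] => move: (nat_of_ord x) => ? end.

Lemma Fp_val_lt (p : nat) (x : 'F_p) : prime p -> (x < p)%N.
Proof. by move=> p_pr; rewrite -[ltnRHS](Fp_cast p_pr). Qed.

Lemma Fp_natr_val (p : nat) (x : 'F_p) : (x : nat)%:R = x.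
Proof. exact: natr_Zp. Qed.

Lemma Fp_natr_eq0 (p n : nat) : prime p -> (n%:R == 0 :> 'F_p) = (p %| n)%N.
Proof. by move=> p_pr; rewrite (dvdn_pcharf (pchar_Fp p_pr)). Qed.

Lemma Fp_val_gt0 (p : nat) (x : 'F_p) : x != 0 -> (0 < x)%N.
Proof. by rewrite lt0n. Qed.

Lemma Fp_val_opp (p : nat) (x : 'F_p) :
  prime p -> x != 0 -> (x + (- x)%R = p)%N.
Proof.
move=> p_pr x0; have /andP[xl nl] : (x < p)%N && ((- x)%R < p)%N.
  by rewrite !Fp_val_lt.
have : (p %| x + (- x)%R)%N by rewrite -Fp_natr_eq0 // natrD !Fp_natr_val subrr.
case/dvdnP=> q; have := Fp_val_gt0 x0; have := prime_gt0 p_pr.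
by case: q => [|[|q]]; nia.
Qed.

Lemma Fp_val_sum3 (p : nat) (x y z : 'F_p) : prime p ->
  x != 0 -> y != 0 -> z != 0 -> x + y + z = 0 ->
  (x + y + z = p \/ x + y + z = 2 * p)%N.
Proof.
move=> p_pr x0 y0 z0 s0.
have xl := Fp_val_lt x p_pr; have yl := Fp_val_lt y p_pr.
have zl := Fp_val_lt z p_pr; have xg := Fp_val_gt0 x0.
have : (p %| x + y + z)%N by rewrite -Fp_natr_eq0 // !natrD !Fp_natr_val s0.
case/dvdnP=> q eq_q; have := prime_gt0 p_pr.
by case: q eq_q => [|[|[|q]]] eq_q; [lia|left; lia|right; lia|nia].
Qed.

Definition carry_sum (p : nat) (k j : 'F_p) : nat :=
  j + (k * j)%R + (- (1 + k) * j)%R.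

Lemma carry_sumP (p : nat) (k j : 'F_p) : prime p ->
  k != 0 -> 1 + k != 0 -> j != 0 ->
  carry_sum k j = p \/ carry_sum k j = (2 * p)%N.
Proof.
move=> p_pr k0 k1 j0; apply: Fp_val_sum3; rewrite ?mulf_neq0 ?oppr_eq0 //.
by ring.
Qed.

Lemma carry_sum_opp (p : nat) (k j : 'F_p) : prime p ->
  k != 0 -> 1 + k != 0 -> j != 0 ->
  (carry_sum k j + carry_sum k (- j)%R = 3 * p)%N.
Proof.
move=> p_pr k0 k1 j0; rewrite /carry_sum !mulrN.
have h1 := Fp_val_opp p_pr j0.
have h2 := Fp_val_opp p_pr (mulf_neq0 k0 j0).
have h3 : ((- (1 + k) * j)%R + (- (- (1 + k) * j))%R = p)%N.
  by apply: Fp_val_opp; rewrite // mulf_neq0 // oppr_eq0.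
by move: h1 h2 h3; gen_ord; lia.
Qed.

(** * Elementary arithmetic: Thue's lemma and a quadratic form *)

(** Pigeonhole: among more than [p] pairs [(a, b)], two give the same [w a - b]; subtract them.
    Since [n < p] and [w != 0], neither difference vanishes. *)
Lemma thue (p n : nat) (w : 'F_p) : prime p -> w != 0 -> (p < n.+1 ^ 2)%N ->
  (n < p)%N ->
  exists t r : nat, [/\ (0 < t <= n)%N, (0 < r <= n)%N &
    w * t%:R = r%:R \/ w * t%:R = - r%:R].
Proof.
move=> p_pr w0 pn np.
pose f (ab : 'I_n.+1 * 'I_n.+1) : 'F_p := w * (ab.1 : nat)%:R - (ab.2 : nat)%:R.
have /injectivePn[[a b] [[c d] neq]] : ~~ injectiveb f.
  apply/negP=> /injectiveP /leq_card.
  by rewrite card_prod !card_ord Fp_cast // leqNgt mulnn pn.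
have nat_inj (m m' : nat) : (m <= n)%N -> (m' <= n)%N ->
    m%:R = m'%:R :> 'F_p -> m = m'.
  move=> mn m'n; have lt_p i : (i <= n)%N -> (i < p)%N by lia.
  by move=> /(congr1 val); rewrite /= !val_Fp_nat // !modn_small ?lt_p.
have an := ltn_ord a; have bn := ltn_ord b.
have cn := ltn_ord c; have dn := ltn_ord d.
wlog lt_ca : a b c d neq an bn cn dn / (c <= a)%N.
  move=> IH; case/orP: (leq_total c a); first exact: IH.
  by move=> le_ac eqf; apply: (IH c d a b) => //; rewrite eq_sym.
rewrite /f /= => eqf.
have eqf' : w * (a - c)%:R = b%:R - d%:R.
  by rewrite natrB //; apply/eqP; rewrite -subr_eq0; apply/eqP;
     move: eqf => /eqP; rewrite -subr_eq0 => /eqP <-; ring.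
have ac : (c < a)%N.
  rewrite ltn_neqAle lt_ca andbT; apply: contra neq => /eqP eq_ca.
  move: eqf'; rewrite eq_ca subnn mulr0 => /esym/eqP; rewrite subr_eq0 => /eqP bd.
  rewrite -pair_eqE /pair_eq /= -!val_eqE /= eq_ca eqxx /=.
  by apply/eqP/nat_inj.
have ne0 : w * (a - c)%:R != 0 by rewrite mulf_neq0 // Fp_natr_eq0 // gtnNdvd; lia.
exists (a - c)%N; case: (ltngtP b d) => [lt_bd|lt_db|eq_bd].
- exists (d - b)%N; split; [lia|lia|right].
  by rewrite eqf' natrB 1?ltnW // opprB.
- by exists (b - d)%N; split; [lia|lia|left]; rewrite eqf' natrB 1?ltnW.
- by move: ne0; rewrite eqf' eq_bd subrr eqxx.
Qed.

Lemma prime_neq_sqr (p n : nat) : prime p -> p != (n ^ 2)%N.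
Proof.
move=> p_pr; apply/eqP => pn; move: p_pr; rewrite pn.
case: n {pn} => [|[|n]] // /primeP[_ /(_ n.+2)].
rewrite expnS expn1 dvdn_mulr // => /(_ isT) /orP[] /eqP; nia.
Qed.

(** The form is even only when [t] and [r] both are, and then it is divisible by 4. *)
Lemma norm_form_neq_double (p t r : nat) : odd p ->
  (t ^ 2 + t * r + r ^ 2 <> 2 * p)%N.
Proof.
move=> p_odd eq_q.
have /andP[/negPf tE /negPf rE] : ~~ odd t && ~~ odd r.
  have := congr1 odd eq_q; rewrite !oddD !oddX !oddM /=.
  by rewrite p_odd; case: (odd t) (odd r) => [] [].
have tE2 := odd_double_half t; have rE2 := odd_double_half r.
move: eq_q; rewrite -tE2 -rE2 tE rE -!muln2 => eq_q.
have pE : p = (2 * (t./2 ^ 2 + t./2 * r./2 + r./2 ^ 2))%N by nia.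
by move: p_odd; rewrite pE oddM.
Qed.

(** As [x' z' = y' z = x y], the sum [y' (x' z') + x' (y' z)] equals both [x' y' J] and
    [x y (x' + y')]. Eliminating [x'] and [y'] leaves [(J^2 - x y) (J - x - y) = 0], whose first
    factor is [p]. *)
Lemma three_products (J p x x' y y' z z' : nat) : (0 < p)%N ->
  (x + x' = J)%N -> (y + y' = J)%N -> (z' + z = J)%N ->
  (x * y + p = J ^ 2)%N -> (x' * z' + p = J ^ 2)%N -> (y' * z + p = J ^ 2)%N ->
  (x + y = J)%N.
Proof.
move=> p0 sx sy sz hxy hx' hy'.
have e1 : (x' * z' = x * y)%N by apply/eqP; rewrite -(eqn_add2r p) hx' hxy.
have e2 : (y' * z = x * y)%N by apply/eqP; rewrite -(eqn_add2r p) hy' hxy.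
have e : (x' * y' * J = x * y * (x' + y'))%N.
  transitivity (y' * (x' * z') + x' * (y' * z))%N; first by rewrite -sz; lia.
  by rewrite e1 e2; lia.
have x'E : x'%:Z = J%:Z - x%:Z by lia.
have y'E : y'%:Z = J%:Z - y%:Z by lia.
have pE : p%:Z = J%:Z ^+ 2 - x%:Z * y%:Z by lia.
have : p%:Z * (J%:Z - x%:Z - y%:Z) = 0.
  move: e => /(congr1 Posz); rewrite !PoszM !PoszD x'E y'E => e.
  by rewrite pE; move/eqP: e; rewrite -subr_eq0 => /eqP e; rewrite -[RHS]e; ring.
by move/eqP; rewrite mulf_eq0 => /orP[]; lia.
Qed.

Lemma sum3_extremal (p a b c d : nat) : (0 < p)%N ->
  a = p \/ a = (2 * p)%N -> b = p \/ b = (2 * p)%N ->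
  c = p \/ c = (2 * p)%N -> d = p \/ d = (2 * p)%N ->
  (a + b + c = d + d + d)%N -> [/\ a = d, b = d & c = d].
Proof.
move=> p0 ha hb hc hd e.
suff: a = d /\ b = d /\ c = d by case=> ? [].
by lia.
Qed.

(** * A primitive cube root of unity in the stabilizer *)

Section CubeRootInStabilizer.
Context (p : nat) (k w : 'F_p).
Hypotheses (p_pr : prime p) (p_odd : odd p) (k0 : k != 0) (k1 : 1 + k != 0).
Hypotheses (w3 : 1 + w + w ^+ 2 = 0).
Hypothesis inv_w : forall j, j != 0 -> carry_sum k (w * j) = carry_sum k j.

Let w0 : w != 0.
Proof.
apply/eqP=> w_eq; move: w3; rewrite w_eq expr0n /= !addr0 => /eqP.
by rewrite oner_eq0.
Qed.

Let w1 : 1 + w != 0.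
Proof.
apply: contraNneq w0 => e; move: w3.
by rewrite e add0r => /eqP; rewrite expf_eq0.
Qed.

(* Summing [carry_sum k] over the orbit of [j] under [w] gives three values of
   [carry_sum w], each [p] or [2 p], with total [3 p] or [6 p]: they all agree. *)
Lemma carry_sum_cube_root (j : 'F_p) : j != 0 ->
  [/\ carry_sum w j = carry_sum k j, carry_sum w (k * j) = carry_sum k j
    & carry_sum w (- (1 + k) * j) = carry_sum k j].
Proof.
move=> j0.
have e1 := inv_w j0; have e2 := inv_w (mulf_neq0 w0 j0).
have w2 : - (1 + w) = w * w.
  by apply/eqP; rewrite -subr_eq0 -oppr_eq0 -w3; apply/eqP; ring.
have c1 := carry_sumP p_pr w0 w1 j0.
have c2 := carry_sumP p_pr w0 w1 (mulf_neq0 k0 j0).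
have k1' : - (1 + k) != 0 by rewrite oppr_eq0.
have c3 := carry_sumP p_pr w0 w1 (mulf_neq0 k1' j0).
have c4 := carry_sumP p_pr k0 k1 j0.
have tot : (carry_sum w j + carry_sum w (k * j)%R + carry_sum w (- (1 + k) * j)%R
  = carry_sum k j + carry_sum k (w * j)%R + carry_sum k (w * (w * j))%R)%N.
  rewrite /carry_sum w2 -!(mulrA w w) !(mulrCA k w) !(mulrCA (- (1 + k)) w).
  by gen_ord; lia.
have pp := prime_gt0 p_pr.
by rewrite e2 e1 in tot; apply: sum3_extremal pp c1 c2 c3 c4 tot.
Qed.

Lemma carry_sum_inv_k (j : 'F_p) : j != 0 ->
  carry_sum k (k * j) = carry_sum k j /\
  carry_sum k (- (1 + k) * j) = carry_sum k j.
Proof.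
move=> j0; have k1' : - (1 + k) != 0 by rewrite oppr_eq0.
have [_ e2 e3] := carry_sum_cube_root j0.
have [e4 _ _] := carry_sum_cube_root (mulf_neq0 k0 j0).
have [e5 _ _] := carry_sum_cube_root (mulf_neq0 k1' j0).
by rewrite -e4 -e5.
Qed.

(* By Thue, [w t = r] or [w t = - r] with [t, r < sqrt p]; the sign and
   [J <= t + r] are forced by the minimality of [J] and the invariance under
   [w], and [t^2 + t r + r^2 = p] as it is [0] mod [p], below [3 p] and not [2 p]. *)
Lemma least_carry_sqr_lt (J : nat) : (0 < J < p)%N ->
  carry_sum k J%:R = (2 * p)%N ->
  (forall j, (0 < j < J)%N -> carry_sum k j%:R = p) -> (J ^ 2 < 2 * p)%N.
Proof.
move=> /andP[J0 Jp] cJ minJ; rewrite ltnNge; apply/negP=> leJ.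
have pp := prime_gt0 p_pr; have p1 := prime_gt1 p_pr.
have nz (n : nat) : (0 < n < p)%N -> n%:R != 0 :> 'F_p.
  by move=> np; rewrite Fp_natr_eq0 // gtnNdvd; lia.
(* [n] is the integer part of the square root of [p]; a prime is no square, so both inequalities are
   strict. *)
have [n n2 pn] : exists2 n, (n ^ 2 < p)%N & (p < n.+1 ^ 2)%N.
  have ex : exists m, (p < m ^ 2)%N by exists p; nia.
  case: (ex_minnP ex) => -[|n] // pn minn; exists n => //.
  rewrite ltn_neqAle eq_sym prime_neq_sqr // leqNgt.
  by apply/negP => /minn; rewrite ltnn.
have nJ : (n < J)%N by nia.
have [t [r [/andP[t0 tn] /andP[r0 rn] wtr]]] := thue p_pr w0 pn (ltn_trans nJ Jp).
have tnz : t%:R != 0 :> 'F_p by apply: nz; lia.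
have rnz : r%:R != 0 :> 'F_p by apply: nz; lia.
have ct : carry_sum k t%:R = p by apply: minJ; lia.
have cr : carry_sum k r%:R = p by apply: minJ; lia.
have {}wtr : w * t%:R = r%:R.
  case: wtr => // wtr; have := inv_w tnz; rewrite wtr ct.
  by move=> cNr; have := carry_sum_opp p_pr k0 k1 rnz; rewrite cr cNr; lia.
(* Here [w r = w^2 t = - (1 + w) t = - (t + r)]. *)
have ctr : carry_sum k (- (t + r)%:R) = p.
  rewrite -[RHS]cr -(inv_w rnz) -wtr; congr carry_sum.
  have -> : (t + r)%:R = t%:R + w * t%:R :> 'F_p by rewrite natrD wtr.
  apply/eqP; rewrite eq_sym -subr_eq0; apply/eqP.
  by rewrite -[RHS](mul0r t%:R) -w3; ring.
have le_tr : (J <= t + r)%N.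
  rewrite leqNgt; apply/negP => lt_tr.
  have := carry_sum_opp p_pr k0 k1 (nz _ (_ : 0 < t + r < p)%N).
  by rewrite ctr minJ; lia.
have : (p %| t ^ 2 + t * r + r ^ 2)%N.
  rewrite -Fp_natr_eq0 // !natrD natrM !natrX -wtr; apply/eqP.
  by rewrite -[RHS](mul0r (t%:R ^+ 2)) -w3; ring.
case/dvdnP=> q eq_q.
have : (q < 3)%N by nia.
(* If [q = 1], then [(t + r)^2 = p + t r < 2 p], against [J <= t + r]. *)
case: q eq_q => [|[|[|q]]] // eq_q _; [nia|nia|].
exact: norm_form_neq_double p_odd eq_q.
Qed.

(* Let [J] be the least integer outside [M].  As [M] is stable under [k] and
   [k' = - (1 + k)], the six residues [x, x', y, y', z, z'] of [- J] times the
   quotients of two of [1, k, k'] add up to [J] in pairs, and [J^2 < 2 p] forces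
   [x y = x' z' = y' z = J^2 - p]. *)
Lemma cube_root_eq : 1 + k + k ^+ 2 = 0.
Proof.
have pp := prime_gt0 p_pr; have p1 := prime_gt1 p_pr.
have k1' : - (1 + k) != 0 by rewrite oppr_eq0.
have nz (n : nat) : (0 < n < p)%N -> n%:R != 0 :> 'F_p.
  by move=> np; rewrite Fp_natr_eq0 // gtnNdvd; lia.
(* The sum is at most [1 + 2 (p - 1) < 2 p]. *)
have c1 : carry_sum k 1 = p.
  have le1 : (((1 : 'F_p)%R : nat) <= 1)%N by rewrite (val_Fp_nat p_pr 1) leq_mod.
  have := carry_sumP p_pr k0 k1 (oner_neq0 _); rewrite /carry_sum !mulr1.
  have := Fp_val_lt k p_pr; have := Fp_val_lt (- (1 + k)) p_pr.
  by move: le1; gen_ord; lia.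
have [J [J0 Jp cJ minJ]] : exists J, [/\ (0 < J)%N, (J < p)%N,
    carry_sum k J%:R = (2 * p)%N &
    forall j, (0 < j < J)%N -> carry_sum k j%:R = p].
  have ex : exists j, (0 < j < p)%N && (carry_sum k j%:R != p).
    exists p.-1; apply/andP; split; first by lia.
    have -> : p.-1%:R = -1 :> 'F_p.
      by rewrite -subn1 natrB // pchar_Fp_0 // sub0r.
    have := carry_sum_opp p_pr k0 k1 (oner_neq0 _); rewrite c1 => e.
    by apply/eqP => e'; move: e; rewrite e'; lia.
  case: (ex_minnP ex) => J /andP[/andP[J0 Jp] cJ] minJ; exists J; split=> //.
    by case: (carry_sumP p_pr k0 k1 (nz J _)) cJ => [|->|//]; [lia|rewrite eqxx].
  move=> j /andP[j0 jJ]; apply/eqP/negPn/negP => cj.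
  by have := minJ j; rewrite cj j0 (ltn_trans jJ Jp) => /(_ isT); lia.
have J2 : (J ^ 2 < 2 * p)%N by apply: least_carry_sqr_lt; rewrite ?J0.
have Jnz : J%:R != 0 :> 'F_p by apply: nz; lia.
set m : 'F_p := - J%:R.
have m0 : m != 0 by rewrite oppr_eq0.
have mE : nat_of_ord m = (p - J)%N.
  have := Fp_val_opp p_pr Jnz; rewrite -/m val_Fp_nat // modn_small //; lia.
have cm : carry_sum k m = p.
  have := carry_sum_opp p_pr k0 k1 Jnz; rewrite -/m cJ; lia.
have cmk : carry_sum k (k^-1 * m) = p.
  have [<- _] := carry_sum_inv_k (mulf_neq0 (invr_neq0 k0) m0).
  by rewrite mulrA divff // mul1r.
have cmk' : carry_sum k ((- (1 + k))^-1 * m) = p.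
  have [_ <-] := carry_sum_inv_k (mulf_neq0 (invr_neq0 k1') m0).
  by rewrite mulrA divff // mul1r.
(* The integer [J^2 - a b] is a multiple of [p] strictly between [0] and [2 p]. *)
have prod_eq (a b : 'F_p) : a != 0 -> b != 0 -> (a < J)%N -> (b < J)%N ->
    a * b = m ^+ 2 -> (a * b + p = J ^ 2)%N.
  move=> a0 b0 aJ bJ ab; have ag := Fp_val_gt0 a0; have bg := Fp_val_gt0 b0.
  have lt_ab : (a * b < J ^ 2)%N by rewrite -mulnn ltn_mul.
  have : (p %| J ^ 2 - a * b)%N.
    rewrite -Fp_natr_eq0 // natrB 1?ltnW // natrM !Fp_natr_val ab natrX.
    by rewrite /m sqrrN subrr.
  case/dvdnP=> q eq_q; have : (q < 2)%N.
    by rewrite -(ltn_pmul2r pp) -eq_q (leq_ltn_trans (leq_subr _ _) J2).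
  move: lt_ab eq_q; case: q => [|[|q]] // lt_ab eq_q _.
    by move: lt_ab; rewrite -subn_gt0 eq_q.
  by rewrite -(subnK (ltnW lt_ab)) eq_q mul1n addnC.
have a0 := mulf_neq0 k0 m0; have b0 := mulf_neq0 k1' m0.
have c0 := mulf_neq0 (invr_neq0 k0) m0.
have d0 := mulf_neq0 (invr_neq0 k1') m0.
have e0 := mulf_neq0 k1' c0; have f0 := mulf_neq0 k0 d0.
have mJ (a b : nat) : (a + m + b = p)%N -> (a + b = J)%N.
  by rewrite mE addnAC addnBA 1?ltnW // => /eqP; rewrite -(eqn_add2r J)
    subnK ?(leq_trans (ltnW Jp)) ?leq_addl // addnC eqn_add2l => /eqP.
have s1 : ((k * m)%R + (- (1 + k) * m)%R = J)%N.
  by apply: mJ; rewrite (addnC _ m).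
have s2 : ((k^-1 * m)%R + (- (1 + k) * (k^-1 * m))%R = J)%N.
  by apply: mJ; move: cmk; rewrite /carry_sum (mulrA k) divff // mul1r.
have s3 : (((- (1 + k))^-1 * m)%R + (k * ((- (1 + k))^-1 * m))%R = J)%N.
  apply: mJ; move: cmk'.
  by rewrite /carry_sum (mulrA (- (1 + k)) _ m) divff // mul1r addnAC.
have ltJ (a b : 'F_p) : (a + b)%N = J -> a != 0 -> b != 0 ->
    (a < J)%N /\ (b < J)%N.
  move=> <- a_nz b_nz; rewrite -[ltnLHS]addn0 ltn_add2l Fp_val_gt0 //.
  by rewrite -[ltnLHS]add0n ltn_add2r Fp_val_gt0.
have [aJ bJ] := ltJ _ _ s1 a0 b0.
have [cJ' eJ] := ltJ _ _ s2 c0 e0.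
have [dJ fJ] := ltJ _ _ s3 d0 f0.
have p1' : ((k * m)%R * (k^-1 * m)%R + p = J ^ 2)%N.
  by apply: prod_eq => //; field.
have p2 : ((- (1 + k) * m)%R * ((- (1 + k))^-1 * m)%R + p = J ^ 2)%N.
  by apply: prod_eq => //; field.
have p3 : ((- (1 + k) * (k^-1 * m))%R * (k * ((- (1 + k))^-1 * m))%R + p
    = J ^ 2)%N.
  by apply: prod_eq => //; field; rewrite k1'.
have sumJ : ((k * m)%R + (k^-1 * m)%R = J)%N.
  exact: three_products pp s1 s2 s3 p1' p2 p3.
have : k * m + k^-1 * m + m = 0.
  by rewrite -[k * m]Fp_natr_val -[k^-1 * m]Fp_natr_val -natrD sumJ subrr.
by move=> eq0; apply: (mulIf m0); rewrite mul0r -[RHS](mulr0 k) -eq0; field.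
Qed.
End CubeRootInStabilizer.

(** * The stabilizer *)

Lemma Fp_unit_neq0 (p : nat) (j : {unit 'F_p}) : val j != 0.
Proof. by rewrite -unitfE; exact: valP. Qed.

Lemma val_unitN1M (p : nat) (j : {unit 'F_p}) : val (unitN1 p * j)%g = - val j.
Proof. by rewrite /= mulN1r. Qed.

Lemma multiplier_neq0 (p k : nat) : prime p -> (0 < k)%N -> (k <= p - 2)%N ->
  k%:R != 0 :> 'F_p /\ 1 + k%:R != 0 :> 'F_p.
Proof.
move=> p_pr k_gt0 kp; have p1 := prime_gt1 p_pr.
by rewrite -(natrD _ 1 k) !Fp_natr_eq0 // !gtnNdvd; lia.
Qed.

Lemma mem_Mset (p k : nat) (j : {unit 'F_p}) : prime p -> (0 < k)%N -> (k <= p - 2)%N ->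
  (j \in Mset p k) = (carry_sum k%:R (val j) == p).
Proof.
move=> p_pr k_gt0 kp; have p1 := prime_gt1 p_pr.
have [k0 k1] := multiplier_neq0 p_pr k_gt0 kp.
have j0 := Fp_unit_neq0 j.
have k1' : - (1 + k%:R) != 0 :> 'F_p by rewrite oppr_eq0.
have := carry_sumP p_pr k0 k1 j0.
have := Fp_val_gt0 (mulf_neq0 k1' j0); have := Fp_val_lt (- (1 + k%:R) * val j) p_pr.
rewrite inE /residue mul1r /carry_sum.
by gen_ord; case: eqP; lia.
Qed.

(** This makes the matrix entries affine in three residues, so that relations between translates can
    be applied. *)
Lemma Efun_carry_sum (p k : nat) (j : {unit 'F_p}) :
  prime p -> (0 < k)%N -> (k <= p - 2)%N ->
  Efun k j - 1 / 2 = (carry_sum k%:R (val j))%:R / p%:R - 3 / 2.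
Proof.
move=> p_pr k_gt0 kp; have p1 := prime_gt1 p_pr.
have [k0 k1] := multiplier_neq0 p_pr k_gt0 kp.
have pn0 : p%:R != 0 :> rat by rewrite pnatr_eq0; lia.
rewrite /Efun mem_Mset //.
have [->|->] := carry_sumP p_pr k0 k1 (Fp_unit_neq0 j).
  by rewrite eqxx divff //; ring.
have -> : (2 * p == p)%N = false by lia.
by rewrite natrM mulfK //; ring.
Qed.

Lemma mem_MsetN (p k : nat) (j : {unit 'F_p}) :
  prime p -> (0 < k)%N -> (k <= p - 2)%N ->
  ((unitN1 p * j)%g \in Mset p k) = (j \notin Mset p k).
Proof.
move=> p_pr k_gt0 kp; have p1 := prime_gt1 p_pr.
have [k0 k1] := multiplier_neq0 p_pr k_gt0 kp.
have := carry_sum_opp p_pr k0 k1 (Fp_unit_neq0 j).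
have := carry_sumP p_pr k0 k1 (Fp_unit_neq0 j).
rewrite !mem_Mset // val_unitN1M.
by case=> ->; move: (carry_sum _ (- _)) => c; lia.
Qed.

Lemma mem_Mset1 (p k : nat) : prime p -> (0 < k)%N -> (k <= p - 2)%N ->
  1%g \in Mset p k.
Proof.
move=> p_pr k_gt0 kp; have p1 := prime_gt1 p_pr.
have v1 : val (1%g : {unit 'F_p}) = 1 by [].
rewrite inE /residue v1 !mulr1 val_Fp_nat // (val_Fp_nat p_pr 1).
by rewrite !modn_small; lia.
Qed.

Lemma carry_sum_Wset (p k : nat) (w j : {unit 'F_p}) :
  prime p -> (0 < k)%N -> (k <= p - 2)%N -> w \in Wset p k ->
  carry_sum k%:R (val w * val j) = carry_sum k%:R (val j).
Proof.
move=> p_pr k_gt0 kp wW; have p1 := prime_gt1 p_pr.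
have [k0 k1] := multiplier_neq0 p_pr k_gt0 kp.
have := Wset_mem j wW; rewrite !mem_Mset //=.
have := carry_sumP p_pr k0 k1 (Fp_unit_neq0 j).
have := carry_sumP p_pr k0 k1 (Fp_unit_neq0 (w * j)%g).
rewrite [val _]/=.
by move=> [->|->] [->|->] //; rewrite eqxx => /esym; lia.
Qed.

Lemma cube_root_unity (F : fieldType) (x : F) :
  x != 1 -> x * (x * x) = 1 -> 1 + x + x ^+ 2 = 0.
Proof.
rewrite -subr_eq0 => x1 x3; apply: (mulfI x1).
by rewrite mulr0; transitivity (x * (x * x) - 1); [ring|rewrite x3 subrr].
Qed.

(** By Cauchy, otherwise [W] has an element of order 2 or 3. The former is [-1], which exchanges [M]
    with its complement; the latter is excluded by [cube_root_eq]. *)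
Lemma coprime_Wset (p k : nat) : prime p -> odd p -> (0 < k)%N -> (k <= p - 2)%N ->
  1 + k%:R + k%:R ^+ 2 != 0 :> 'F_p -> coprime #|Wset p k| 6.
Proof.
move=> p_pr p_odd k_gt0 kp nk; have p1 := prime_gt1 p_pr.
have [k0 k1] := multiplier_neq0 p_pr k_gt0 kp.
rewrite -[6%N]/(2 * 3)%N coprimeMr (coprime_sym _ 2) (coprime_sym _ 3).
rewrite !prime_coprime //.
apply/andP; split; apply/negP=> /(Cauchy (G := Wset_group p k))-/(_ isT) [w wW ow].
  have w_neq1 : w != 1%g by rewrite -order_eq1 ow.
  have wN1 : w = unitN1 p.
    have : val (w ^+ 2)%g = 1 by rewrite -ow expg_order.
    rewrite expgS expg1 /= -expr2 => /eqP; rewrite sqrf_eq1 => /orP[] /eqP e.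
      by case/eqP: w_neq1; apply: val_inj.
    exact: val_inj.
  have := Wset_mem 1%g wW; rewrite wN1 mem_MsetN // mem_Mset1 //.
have w_neq1 : val w != 1.
  by apply/eqP=> e; have : #[w]%g == 1%N; [rewrite order_eq1; apply/eqP/val_inj|rewrite ow].
have w3 : 1 + val w + val w ^+ 2 = 0.
  apply: cube_root_unity w_neq1 _; have := congr1 val (expg_order w).
  by rewrite ow FinRing.val_unitX !exprS expr0 mulr1.
case/eqP: nk; apply: (cube_root_eq p_pr p_odd k0 k1 w3) => j j0.
have uj : j \is a GRing.unit by rewrite unitfE.
have := carry_sum_Wset (FinRing.unit 'F_p uj) p_pr k_gt0 kp wW.
exact.
Qed.

(** * A kernel vector of the Demjanenko matrix *)

Lemma sum_orbits (p k : nat) (g : {unit 'F_p} -> rat) :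
  (forall w a, w \in Wset p k -> g (w * a)%g = g a) ->
  \sum_(a in Mset p k) g a =
  #|Wset p k|%:R * \sum_(s < #|orbits p k|) g (repr (enum_val s)).
Proof.
move=> g_inv.
rewrite (partition_big (rcoset (Wset p k)) (mem (orbits p k))) /=; last first.
  by move=> a aM; apply: imset_f.
rewrite -(big_enum_val (fun O : {set {unit 'F_p}} => g (repr O))) mulr_sumr.
apply: eq_bigr => O Oorb; rewrite mulr_natl.
have [b bM Ob] := imsetP Oorb; rewrite rcosetE in Ob.
have inO a : (a \in Mset p k) && (rcoset (Wset p k) a == O) = (a \in O).
  rewrite Ob rcosetE (sameP eqP (@rcoset_eqP _ (Wset_group p k) a b)).
  case: rcosetP => [[w wW ->]|_]; last by rewrite andbF.
  by rewrite Wset_mem // bM.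
rewrite (eq_bigl _ _ inO) -(card_rcoset (Wset p k) b) -Ob -sumr_const.
by apply: eq_bigr => a /(mem_orbit_repr Oorb)[w wW ->]; rewrite g_inv.
Qed.

Lemma sum_Mset (p k : nat) (g : {unit 'F_p} -> rat) :
  prime p -> (0 < k)%N -> (k <= p - 2)%N ->
  (forall a, g (unitN1 p * a)%g = g a) ->
  \sum_a g a = 2 * \sum_(a in Mset p k) g a.
Proof.
move=> p_pr k_gt0 kp g_even; rewrite (bigID (mem (Mset p k))) /=.
rewrite [X in _ + X](reindex_inj (mulgI (unitN1 p))) /= mulr2n mulrDl mul1r.
congr (_ + _); apply: eq_big => a; last by rewrite g_even.
by rewrite mem_MsetN // negbK.
Qed.

(** Moving the factors [u] and [v] from the residues onto [phi] gives each residue the coefficient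
    [phi b + phi (b / u) + phi (b / v) = 0]. The constant [3 / 2] contributes nothing: summing the
    same relation over the group gives three times the sum of [phi]. *)
Lemma sum_Efun_eq0 (p k : nat) (u v : {unit 'F_p}) (phi : {unit 'F_p} -> rat) :
  prime p -> (0 < k)%N -> (k <= p - 2)%N ->
  val u = k%:R -> val v = - (1 + k%:R) ->
  (forall a, phi a + phi (u^-1 * a)%g + phi (v^-1 * a)%g = 0) ->
  \sum_b (Efun k b - 1 / 2) * phi b = 0.
Proof.
move=> p_pr k_gt0 kp uE vE phi3.
pose r (b : {unit 'F_p}) : rat := (val b : nat)%:R.
have shift (f : {unit 'F_p} -> rat) (c : {unit 'F_p}) :
    \sum_b f (c * b)%g * phi b = \sum_b f b * phi (c^-1 * b)%g.
  by rewrite [RHS](reindex_inj (mulgI c)); apply: eq_bigr => b _; rewrite mulKg.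
have E b : (Efun k b - 1 / 2) * phi b = p%:R^-1 * (r b * phi b
    + r (u * b)%g * phi b + r (v * b)%g * phi b) - 3 / 2 * phi b.
  rewrite Efun_carry_sum // /carry_sum !natrD -vE -uE /r /=; ring.
rewrite (eq_bigr _ (fun b _ => E b)) sumrB -!mulr_sumr !big_split /= !shift.
rewrite -!big_split /= (eq_bigr (fun _ => 0)) => [|b _]; last first.
  by rewrite -!mulrDr phi3 mulr0.
have phi_shift c : \sum_b phi b = \sum_b phi (c^-1 * b)%g.
  by rewrite (reindex_inj (mulgI c^-1%g)).
have : \sum_b phi b + \sum_b phi b + \sum_b phi b = 0.
  rewrite {2}(phi_shift u) {2}(phi_shift v) -!big_split /=.
  by rewrite (eq_bigr (fun _ => 0)) ?sumr_const ?mul0rn.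
rewrite sumr_const mul0rn; lra.
Qed.

(** The kernel vector lists the values of [phi] on the orbits. Both [E - 1/2] and [phi] are odd, so
    their product is even and its sum over orbits is a multiple of its sum over the whole group. *)
Lemma det_Demjanenko_eq0 (p k : nat) (u v : {unit 'F_p})
    (phi : {unit 'F_p} -> rat) :
  prime p -> (0 < k)%N -> (k <= p - 2)%N ->
  val u = k%:R -> val v = - (1 + k%:R) ->
  (forall w a, w \in Wset p k -> phi (w * a)%g = phi a) ->
  (forall a, phi (unitN1 p * a)%g = - phi a) ->
  (forall a, phi a + phi (u^-1 * a)%g + phi (v^-1 * a)%g = 0) ->
  phi 1%g != 0 ->
  \det (Demjanenko p k) = 0.
Proof.
move=> p_pr k_gt0 kp uE vE phiW phiN phi3 phi1.
rewrite -det_tr; apply/eqP/det0P.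
exists (\row_s phi (repr (enum_val s))).
  have M1 := mem_Mset1 p_pr k_gt0 kp.
  have O1 : rcoset (Wset p k) 1 \in orbits p k by apply: imset_f.
  apply: contraNneq phi1 => /rowP /(_ (enum_rank_in O1 (rcoset (Wset p k) 1))).
  rewrite !mxE enum_rankK_in // => e.
  have : 1%g \in rcoset (Wset p k) 1.
    by rewrite rcosetE (rcoset_refl (Wset_group p k)).
  by case/(mem_orbit_repr O1) => w wW ->; rewrite phiW // e.
apply/rowP=> i; rewrite !mxE.
set c := repr (enum_val i).
pose m := unitN1 p.
have mm : (m * m = 1)%g by apply: val_inj; rewrite /= mulrNN mulr1.
pose g a := (Efun k (m * c^-1 * a)%g - 1 / 2) * phi a.
have gW w a : w \in Wset p k -> g (w * a)%g = g a.
  move=> wW; rewrite /g phiW // (Fp_unit_mulgC w a) mulgA.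
  by rewrite (Fp_unit_mulgC _ w) Efun_W.
have EN a : Efun k (m * a)%g = 1 - Efun k a.
  by rewrite /Efun mem_MsetN //; case: (a \in _); rewrite ?subr0 ?subrr.
have gN a : g (m * a)%g = g a.
  rewrite /g phiN (Fp_unit_mulgC m a) mulgA (Fp_unit_mulgC _ m) EN.
  by field.
have tot : \sum_a g a = 0.
  (* Translation by [- c] absorbs the factor [- c^-1] of the row; the relation on [phi] survives
     it. *)
  rewrite (reindex_inj (mulgI (c * m)%g)) /= /g.
  pose phi' a := phi (c * m * a)%g.
  rewrite -[RHS](@sum_Efun_eq0 p k u v phi') //.
    apply: eq_bigr => a _; congr ((Efun k _ - _) * _).
    rewrite (Fp_unit_mulgC m) -!mulgA (mulgA m) (Fp_unit_mulgC m c) -!mulgA.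
    by rewrite (mulgA m m) mm mul1g mulKg.
  move=> a; rewrite /phi'.
  have swap x : (c * m * (x * a) = x * (c * m * a))%g.
    by rewrite mulgA (Fp_unit_mulgC (c * m)%g) -mulgA.
  by rewrite !swap.
have W0 : #|Wset p k|%:R != 0 :> rat.
  by rewrite pnatr_eq0 -lt0n (cardG_gt0 (Wset_group p k)).
have : 2 * (#|Wset p k|%:R * \sum_(s < #|orbits p k|) g (repr (enum_val s))) = 0.
  by rewrite -(sum_orbits gW) -sum_Mset.
move/eqP; rewrite !mulf_eq0 pnatr_eq0 (negPf W0) /= => /eqP.
by apply: etrans; apply: eq_bigr => s _; rewrite !mxE mulrC.
Qed.

(** * Solutions in cosets *)

Lemma mulrn_int (x : int) (n : nat) : x *+ n = n%:Z * x.
Proof. by rewrite -mulr_natl natz. Qed.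

(* Only the diagonal terms of the expanded square contribute: the indicator of
   [B] minus its mean sums to [0]. *)
Lemma affine_second_moment (F : finFieldType) (A B : {set F}) :
  \sum_u \sum_v (#|F|%:Z * #|[set a in A | u * a + v \in B]|%:Z
                 - #|A|%:Z * #|B|%:Z) ^+ 2
  <= #|F|%:Z ^+ 3 * #|A|%:Z * #|B|%:Z.
Proof.
(* The centred indicator of [B], scaled by [q] to stay in the integers. *)
set q := #|F|%:Z; pose e (y : F) : int := q * (y \in B)%:Z - #|B|%:Z.
have card_ind (T : finType) (C : {set T}) : \sum_x (x \in C)%:Z = #|C|%:Z.
  rewrite -sum1_card (big_morph Posz PoszD (erefl _)) [RHS]big_mkcond /=.
  by apply: eq_bigr => x _; case: (x \in C).
have sum_e : \sum_y e y = 0.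
  rewrite sumrB -mulr_sumr card_ind sumr_const.
  by rewrite mulrn_int subrr.
have sum_e2 : \sum_y e y ^+ 2 <= q ^+ 2 * #|B|%:Z.
  have E y : e y ^+ 2 = q * (q - 2 * #|B|%:Z) * (y \in B)%:Z + #|B|%:Z ^+ 2.
    by rewrite /e; case: (y \in B); rewrite ?mulr1 ?mulr0 ?sub0r; ring.
  rewrite (eq_bigr _ (fun y _ => E y)) big_split /= -mulr_sumr card_ind.
  rewrite sumr_const (mulrn_int (_ ^+ 2)); change (#|xpredT|%:Z) with q.
  rewrite -subr_ge0 [leRHS](_ : _ = q * #|B|%:Z ^+ 2) ?mulr_ge0 ?sqr_ge0 //.
  by rewrite /q; ring.
have G u v : q * #|[set a in A | u * a + v \in B]|%:Z - #|A|%:Z * #|B|%:Z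
    = \sum_(a in A) e (u * a + v).
  rewrite sumrB -mulr_sumr sumr_const mulrn_int; congr (q * _ - _).
  rewrite -card_ind [RHS]big_mkcond /=; apply: eq_bigr => a _.
  by rewrite inE; case: (a \in A).
pose T a b := \sum_u \sum_v e (u * a + v) * e (u * b + v).
have T_neq a b : a != b -> T a b = 0.
  move=> ab; rewrite /T.
  transitivity (\sum_u \sum_v e v * e (u * (b - a) + v)).
    apply: eq_bigr => u _; rewrite (reindex_inj (addrI (- (u * a)))) /=.
    by apply: eq_bigr => v _; congr (e _ * e _); ring.
  rewrite exchange_big /= big1 // => v _.
  rewrite -mulr_sumr; suff -> : \sum_u e (u * (b - a) + v) = 0 by rewrite mulr0.
  transitivity (\sum_y e y); last exact: sum_e.
  rewrite [RHS](reindex_inj (addIr v)) /=.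
  have ba : b - a != 0 by rewrite subr_eq0 eq_sym.
  by rewrite [RHS](reindex_inj (mulIf ba)).
have T_eq a : T a a = q * \sum_y e y ^+ 2.
  rewrite /T (eq_bigr (fun _ => \sum_y e y ^+ 2)) => [|u _].
    by rewrite sumr_const mulrn_int.
  by rewrite [RHS](reindex_inj (addrI (u * a))) /=; apply: eq_bigr.
have -> : \sum_u \sum_v (q * #|[set a in A | u * a + v \in B]|%:Z
      - #|A|%:Z * #|B|%:Z) ^+ 2 = \sum_(a in A) \sum_(b in A) T a b.
  transitivity (\sum_u \sum_(a in A) \sum_(b in A) \sum_v e (u * a + v) * e (u * b + v)).
    apply: eq_bigr => u _.
    under eq_bigr => v _ do rewrite G expr2 mulr_suml.
    rewrite exchange_big /=; apply: eq_bigr => a _.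
    by under eq_bigr => v _ do rewrite mulr_sumr; rewrite exchange_big.
  rewrite exchange_big /=; apply: eq_bigr => a _.
  by rewrite exchange_big.
rewrite (eq_bigr (fun _ => q * \sum_y e y ^+ 2)) => [|a aA]; last first.
  rewrite (bigD1 a) //= T_eq [X in _ + X]big1 ?addr0 // => b /andP[_ ba].
  by rewrite T_neq // eq_sym.
rewrite sumr_const mulrn_int.
have := ler_wpM2l (_ : 0 <= #|A|%:Z * q) sum_e2; rewrite mulr_ge0 // => /(_ isT).
by congr (_ <= _); rewrite /q; ring.
Qed.

(* For [u, v] in [H] the number of [a] in [g H] with [u a + v] in [- g^-1 H] does
   not depend on [(u, v)], which gives [|H|^2] equal terms of the second moment. *)
Lemma few_solutions (F : finFieldType) (h : nat) (g : F) : (0 < h)%N -> g != 0 ->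
  (#|[set k : F | (((k / g) ^+ h == 1) && ((- (1 + k) * g) ^+ h == 1))%R]| <= 2)%N ->
  (#|[set x : F | (x ^+ h == 1)%R]| ^ 4 <= 16 * #|F| ^ 3)%N.
Proof.
set good := [set k | _]; set H := [set x | _ == 1] => h0 g0 le2.
pose A := [set x : F | (x / g) ^+ h == 1].
pose B := [set y : F | (- y * g) ^+ h == 1].
have cA : #|A| = #|H|.
  rewrite -(card_imset (mem H) (mulIf g0)); apply: eq_card => x; rewrite !inE.
  apply/idP/imsetP=> [xA|[y yH ->]]; last by move: yH; rewrite inE mulfK.
  by exists (x / g); rewrite ?inE // divfK.
have cB : #|B| = #|H|.
  have ng : - g^-1 != 0 by rewrite oppr_eq0 invr_eq0.
  rewrite -(card_imset (mem H) (mulIf ng)); apply: eq_card => x; rewrite !inE.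
  apply/idP/imsetP=> [xA|[y yH ->]].
    by exists (- x * g); rewrite ?inE // mulrN !mulNr opprK mulfK.
  by move: yH; rewrite inE mulrN opprK divfK.
have Hn0 x : x \in H -> x != 0.
  rewrite inE; apply: contraTneq => ->.
  by rewrite expr0n eqn0Ngt h0 eq_sym oner_eq0.
(* Dividing [u a + v] by [v] sends [a] to the solution [(u / v) a] of the conditions on [k]. *)
have few u v : u \in H -> v \in H ->
    (#|[set a in A | (u * a + v)%R \in B]| <= 2)%N.
  move=> uH vH; apply: leq_trans le2; have u0 := Hn0 u uH; have v0 := Hn0 v vH.
  have uv0 : u / v != 0 by rewrite mulf_neq0 ?invr_eq0.
  rewrite -(card_imset _ (mulfI uv0)); apply/subset_leq_card/fintype.subsetP => x.
  case/imsetP=> a; rewrite !inE => /andP[/eqP aA /eqP aB] ->.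
  move: uH vH; rewrite !inE => /eqP uH /eqP vH.
  have -> : u / v * a / g = (u / v) * (a / g) by rewrite mulrA.
  have -> : - (1 + u / v * a) * g = v^-1 * (- (u * a + v) * g).
    by field.
  rewrite [_ ^+ h]exprMn aA exprMn exprVn uH vH invr1 !mul1r.
  by rewrite exprMn exprVn vH aB invr1 !mulr1 eqxx.
have := affine_second_moment A B; rewrite cA cB => le_sum.
set n := #|H| in le_sum *; set q := #|F| in le_sum *.
have q0 : (0 < q)%N by apply/card_gt0P; exists 0.
(* If [n^2 < 4 q] the claim is immediate. Otherwise a count [c <= 2] satisfies [q c <= n^2 / 2], so
   each term with [u, v] in [H] is at least [n^4 / 4]. *)
have [lt4|ge4] := ltnP (n ^ 2) (4 * q); first by nia.
have term u v : u \in H -> v \in H -> (n%:Z ^+ 2) ^+ 2 <=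
    4 * (q%:Z * #|[set a in A | u * a + v \in B]|%:Z - n%:Z * n%:Z) ^+ 2.
  move=> uH vH; have := few u v uH vH.
  move: #|[set a in A | _]| => c c2.
  have : n%:Z ^+ 2 <= 2 * (n%:Z * n%:Z - q%:Z * c%:Z) by nia.
  have : 0 <= n%:Z ^+ 2 by rewrite sqr_ge0.
  nia.
have low : n%:Z * (n%:Z * (n%:Z ^+ 2) ^+ 2) <= 4 * (q%:Z ^+ 3 * n%:Z * n%:Z).
  apply: le_trans (ler_wpM2l _ le_sum) => //.
  rewrite mulr_sumr (bigID (mem H)) /= -[leLHS]addr0; apply: lerD; last first.
    by apply: sumr_ge0 => u _; rewrite mulr_ge0 // sumr_ge0 // => v _; rewrite sqr_ge0.
  rewrite -mulrn_int -sumr_const; apply: ler_sum => u uH.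
  rewrite mulr_sumr (bigID (mem H)) /= -[leLHS]addr0; apply: lerD; last first.
    by apply: sumr_ge0 => v _; rewrite mulr_ge0 // sqr_ge0.
  rewrite -mulrn_int -sumr_const; apply: ler_sum => v vH.
  exact: term.
have n0 : (0 < n)%N by nia.
have : (n%:Z * n%:Z) * (n%:Z ^+ 2) ^+ 2 <= (n%:Z * n%:Z) * (4 * q%:Z ^+ 3).
  by move: low; congr (_ <= _); ring.
rewrite ler_pM2l ?mulr_gt0 //.
nia.
Qed.

(** * Roots of unity, and singular matrices from coset conditions *)

Lemma Fp_unit_generator (p : nat) : prime p ->
  exists z : {unit 'F_p}, #[z]%g = p.-1.
Proof.
move=> p_pr; have /cyclicP[z zE] := field_unit_group_cyclic [set: {unit 'F_p}]%G.
by exists z; rewrite orderE -zE card_finField_unit card_Fp.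
Qed.

Lemma card_unity_roots (p h : nat) : prime p -> (h %| p.-1)%N ->
  (h <= #|[set x : 'F_p | (x ^+ h == 1)%R]|)%N.
Proof.
move=> p_pr; have [z oz] := Fp_unit_generator p_pr; case/dvdnP=> m hm.
have p1 := prime_gt1 p_pr.
have m0 : (0 < m)%N by case: m hm => //; lia.
have oh : #[z ^+ m]%g = h by rewrite orderXdiv oz hm ?dvdn_mulr // mulKn.
rewrite -{1}oh orderE -(card_imset _ val_inj).
apply/subset_leq_card/fintype.subsetP=> _ /imsetP[x xz ->]; rewrite inE.
have := expg_cardG xz; rewrite -orderE oh => /(congr1 val).
by rewrite FinRing.val_unitX => ->.
Qed.

Section CosetConditions.
Context (p h s : nat) (k : nat) (g u v : {unit 'F_p}).
Hypotheses (p_pr : prime p) (p_odd : odd p).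
Hypotheses (k_gt0 : (0 < k)%N) (kp : (k <= p - 2)%N).
Hypotheses (h_odd : odd h) (hE : p.-1 = (2 ^ s * 3 * h)%N).
Hypotheses (uE : val u = k%:R) (vE : val v = - (1 + k%:R)).
Hypotheses (g3 : (g ^+ (3 * h) = 1)%g) (g1 : (g ^+ h != 1)%g).
Hypotheses (ug : ((u * g^-1) ^+ h = 1)%g) (vg : ((v * g) ^+ h = 1)%g).
Hypothesis not_cube_root : 1 + k%:R + k%:R ^+ 2 != 0 :> 'F_p.

(** The order of [w] divides [2^s * 3 * h] and is prime to 6. *)
Lemma Wset_unity_root (w : {unit 'F_p}) : w \in Wset p k -> (w ^+ h = 1)%g.
Proof.
move=> wW; apply/eqP; rewrite -order_dvdn.
have cop := coprime_Wset p_pr p_odd k_gt0 kp not_cube_root.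
have cw : coprime #[w]%g (2 ^ s * 3).
  have ow : (#[w]%g %| #|Wset p k|)%N := @order_dvdG _ (Wset_group p k) w wW.
  apply: coprime_dvdl ow _.
  by move: cop; rewrite -[6%N]/(2 * 3)%N !coprimeMr => /andP[c2 ->]; rewrite coprimeXr.
rewrite -(Gauss_dvdr _ cw) -hE order_dvdn; apply/eqP.
by have := expg_cardG (finset.in_setT w); rewrite card_finField_unit card_Fp.
Qed.

(** Raising to the power [h] collapses each coset of [H] to a point: [f (a ^+ h)] is [psi a]. Since
    [u^h = z] and [v^h = z^-1] with [z^3 = 1], the three-term relation telescopes around the powers
    of [z]. Oddness of [phi] uses that [h] is odd. *)
Lemma det_Demjanenko_of_cosets : \det (Demjanenko p k) = 0.
Proof.
have p1 := prime_gt1 p_pr.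
pose m := unitN1 p.
have mm : (m * m = 1)%g by apply: val_inj; rewrite /= mulrNN mulr1.
have m_neq1 : m != 1%g.
  rewrite -(inj_eq val_inj) /= -subr_eq0 -opprD oppr_eq0 -(natrD _ 1 1).
  rewrite Fp_natr_eq0 //; rewrite dvdn_prime2 //.
  by apply: contraL p_odd => /eqP ->.
have mh : (m ^+ h = m)%g.
  by rewrite -(odd_double_half h) h_odd -mul2n expgS expgM expgS expg1 mm expg1n mulg1.
pose f (x : {unit 'F_p}) : rat := (x == 1%g)%:R - (x == m)%:R.
have fN x : f (m * x)%g = - f x.
  have e1 : (m * x == m)%g = (x == 1%g).
    by rewrite -[in LHS](inj_eq (mulgI m^-1%g)) mulKg mulVg.
  have e2 : (m * x == 1)%g = (x == m) by rewrite -mm (inj_eq (mulgI m)).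
  by rewrite /f e1 e2 opprB.
pose z := (g ^+ h)%g.
have z3 : (z ^+ 3 = 1)%g by rewrite /z -expgM mulnC.
have expM (a b : {unit 'F_p}) n : ((a * b) ^+ n = a ^+ n * b ^+ n)%g.
  by apply: expgMn; apply: Fp_unit_mulgC.
have uh : (u ^+ h = z)%g.
  by move: ug; rewrite expM expVgn => /eqP; rewrite -eq_mulgV1 => /eqP.
have vh : (v ^+ h = z^-1)%g.
  by move: vg; rewrite expM => /eqP; rewrite -eq_invg_mul => /eqP e; rewrite /z -e invgK.
pose phi (a : {unit 'F_p}) := f (a ^+ h)%g - f (z^-1 * a ^+ h)%g.
apply: (det_Demjanenko_eq0 (phi := phi) p_pr k_gt0 kp uE vE).
- by move=> w a wW; rewrite /phi expM (Wset_unity_root wW) mul1g.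
- move=> a; rewrite /phi expM mh fN mulgA (Fp_unit_mulgC _ m) -mulgA fN.
  by ring.
- move=> a; rewrite /phi !expM !expVgn uh vh invgK !mulgA mulVg mul1g.
  have -> : (z^-1 * z^-1 = z)%g.
    rewrite -invMg; apply/eqP; rewrite eq_invg_mul -z3 !expgS expg0 mulg1.
    by rewrite -mulgA.
  by ring.
- have zm : z^-1%g != m.
    apply/eqP=> zm; case/eqP: m_neq1.
    have <- : (m ^+ 3 = m)%g by rewrite !expgS expg0 mulg1 mm mulg1.
    by rewrite -zm expgVn z3 invg1.
  rewrite /phi expg1n mulg1 /f eqxx invg_eq1 (negPf g1) (negPf zm).
  by rewrite (eq_sym _ m) (negPf m_neq1) !subr0 oner_eq0.
Qed.
End CosetConditions.

Lemma prime_le_of_Kset_eq0 (p : nat) : prime p -> odd p -> (3 %| p.-1)%N ->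
  #|Kset p| = 0%N -> (p <= (12 * 2 ^ logn 2 p.-1) ^ 4)%N.
Proof.
move=> p_pr p_odd p3 K0; have p1 := prime_gt1 p_pr.
have p10 : (0 < p.-1)%N by lia.
set s := logn 2 p.-1.
have [n n_odd pE] : exists2 n, odd n & p.-1 = (2 ^ s * n)%N.
  exists ((p.-1)`_2^')%N; first by rewrite odd_2'nat part_pnat.
  by rewrite -p_part partnC.
have [h hE] : exists h, n = (3 * h)%N.
  have : (3 %| n)%N by move: p3; rewrite pE Gauss_dvdr // coprimeXr.
  by case/dvdnP=> h ->; exists h; rewrite mulnC.
have h_odd : odd h by move: n_odd; rewrite hE oddM.
have h0 : (0 < h)%N by case: h h_odd {hE}.
rewrite {}hE mulnA in pE.
have [z oz] := Fp_unit_generator p_pr.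
(* This [g] has order [3 h]. *)
pose g := (z ^+ (2 ^ s))%g.
have g3 : (g ^+ (3 * h) = 1)%g by rewrite -expgM mulnA -pE -oz expg_order.
have g1 : (g ^+ h != 1)%g.
  rewrite -expgM -order_dvdn oz pE gtnNdvd ?muln_gt0 ?expn_gt0 //.
  by rewrite mulnAC ltn_Pmulr // muln_gt0 expn_gt0.
have g0 : val g != 0 := Fp_unit_neq0 g.
have good_le2 : (#|[set k : 'F_p | (((k / val g) ^+ h == 1) &&
     ((- (1 + k) * val g) ^+ h == 1))%R]| <= 2)%N.
  (* Any solution that is not a root of [P] would give a singular matrix, hence an element of
     [Kset p]. *)
  pose P : {poly 'F_p} := 1 + 'X + 'X^2.
  have sP : size P = 3%N.
    rewrite /P addrC size_polyDl size_polyXn // addrC.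
    by rewrite -[1]/(1%:P) size_XaddC.
  have P0 : P != 0 by rewrite -size_poly_gt0 sP.
  rewrite cardE -ltnS -sP; apply: max_poly_roots (enum_uniq _) => //.
  apply/allP=> k; rewrite mem_enum inE => /andP[ku kv].
  rewrite rootE !hornerE; apply/negPn/negP => not_root.
  have k0 : k != 0.
    by apply: contraTneq ku => ->; rewrite mul0r expr0n eqn0Ngt h0 eq_sym oner_eq0.
  have k1 : - (1 + k) != 0.
    by apply: contraTneq kv => ->; rewrite mul0r expr0n eqn0Ngt h0 eq_sym oner_eq0.
  have k_gt0 := Fp_val_gt0 k0.
  have kp : (k <= p - 2)%N.
    have kp := Fp_val_lt k p_pr.
    rewrite leqNgt; apply/negP => lt_k; case/eqP: k1.
    have kE : (1 + k = p)%N.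
      by apply/eqP; rewrite eqn_leq kp /=; move: lt_k; rewrite ltn_subLR.
    have -> : 1 + k = (1 + k)%N%:R by rewrite natrD Fp_natr_val.
    by rewrite kE pchar_Fp_0 ?oppr0.
  have uu : k \is a GRing.unit by rewrite unitfE.
  have vu : - (1 + k) \is a GRing.unit by rewrite unitfE.
  have det0 : \det (Demjanenko p k) = 0.
    apply: (@det_Demjanenko_of_cosets p h s k g (FinRing.unit _ uu)
      (FinRing.unit _ vu)) => //.
    - by rewrite Fp_natr_val.
    - by rewrite Fp_natr_val.
    - by apply: val_inj; rewrite FinRing.val_unitX; apply/eqP.
    - by apply: val_inj; rewrite FinRing.val_unitX; apply/eqP.
    - by rewrite Fp_natr_val.
  have kp' := Fp_val_lt k p_pr.
  have := card0_eq K0 (Ordinal kp'); rewrite !inE /= k_gt0 kp det0 eqxx.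
  by [].
have := few_solutions h0 g0 good_le2; rewrite card_Fp //.
have := card_unity_roots p_pr (_ : h %| p.-1)%N; rewrite pE dvdn_mull // => /(_ isT).
move: #|_| => c hc c4.
have {c4 hc} : (h ^ 4 <= 16 * p ^ 3)%N.
  by apply: leq_trans c4; rewrite leq_exp2r.
(* From [p <= 2 (p - 1)]: with [t = 2^s], [p^4 <= (6 t)^4 h^4 <= (12 t)^4 p^3]. *)
have : (p <= 2 * (2 ^ s * 3 * h))%N by rewrite -pE; lia.
move: (2 ^ s)%N => t le1 le2.
have : (p ^ 4 <= (2 * (t * 3 * h)) ^ 4)%N by rewrite leq_exp2r.
have -> : ((2 * (t * 3 * h)) ^ 4 = (6 * t) ^ 4 * h ^ 4)%N.
  by rewrite -expnMn; congr (_ ^ _)%N; lia.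
move=> le3; have le4 : (p ^ 4 <= (6 * t) ^ 4 * (16 * p ^ 3))%N.
  by apply: leq_trans le3 _; rewrite leq_mul2l le2 orbT.
have -> : ((12 * t) ^ 4 = (6 * t) ^ 4 * 16)%N.
  by rewrite -[16%N]/(2 ^ 4)%N -expnMn; congr (_ ^ _)%N; lia.
by rewrite -(leq_pmul2r (_ : 0 < p ^ 3)%N) ?expn_gt0 ?prime_gt0 // -expnS -mulnA.
Qed.

(** * Counting the exceptional primes *)

(** The map sending [n] to [(n - 1) / d] embeds [A] into the integers from 1 to [Y / d]. *)
Lemma card_progression (N d Y : nat) (A : {set 'I_N}) : (0 < d)%N ->
  (forall n : 'I_N, n \in A -> [&& 1 < n, d %| n.-1 & n <= Y]%N) ->
  (#|A| * d <= Y)%N.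
Proof.
move=> d0 AP; rewrite -leq_divRL // cardE -(size_map (fun n : 'I_N => n.-1 %/ d)%N).
rewrite -(size_iota 1 (Y %/ d)); apply: uniq_leq_size.
  rewrite map_inj_in_uniq ?enum_uniq // => m n; rewrite !mem_enum.
  move=> /AP/and3P[m1 dm _] /AP/and3P[n1 dn _] e; apply: val_inj => /=.
  by move: (divnK dm) (divnK dn); rewrite e => -> ?; lia.
move=> q /mapP[n]; rewrite mem_enum => /AP/and3P[n1 dn nY] ->.
rewrite mem_iota divn_gt0 // dvdn_leq //=; last by lia.
by rewrite ltnS leq_div2r //; lia.
Qed.

Lemma card_bigcup_le (I T : finType) (F : I -> {set T}) :
  (#|\bigcup_i F i| <= \sum_i #|F i|)%N.
Proof.
elim/big_rec2: _ => [|i B n _ le_nB]; first by rewrite cards0.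
by rewrite (leq_trans (leq_card_setU _ _)) // leq_add2l.
Qed.

Definition valuation_class (N s : nat) : {set 'I_N.+1} :=
  [set n : 'I_N.+1 | [&& (1 < n)%N, logn 2 n.-1 == s & (n <= (12 * 2 ^ s) ^ 4)%N]].

(** With [d = 2^s], the quantity [#|A| d] is bounded by [N] and by [(12 d)^4]. Multiplying three
    copies of the first bound by the second and cancelling [d^4] yields the exponent 3/4. *)
Lemma card_valuation_class (N s : nat) :
  (#|valuation_class N s| ^ 4 <= 12 ^ 4 * N ^ 3)%N.
Proof.
set A := valuation_class N s; set d := (2 ^ s)%N.
have d0 : (0 < d)%N by rewrite expn_gt0.
have dn (n : 'I_N.+1) : n \in A -> [/\ 1 < n, d %| n.-1 & n <= (12 * d) ^ 4]%N.
  rewrite inE => /and3P[n1 /eqP vn le_n]; split=> //.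
  by rewrite /d -vn pfactor_dvdnn.
have leN : (#|A| * d <= N)%N.
  by apply: card_progression => // n /dn[-> -> _]; rewrite -ltnS ltn_ord.
have led : (#|A| * d <= (12 * d) ^ 4)%N.
  by apply: card_progression => // n /dn[-> -> ->].
rewrite -(leq_pmul2r (_ : 0 < d ^ 4)%N) ?expn_gt0 ?d0 //.
rewrite mulnAC -expnMn -expnMn [(_ ^ 4 * _)%N]mulnC.
by rewrite (expnSr (_ * d)) leq_mul // leq_exp2r.
Qed.

(** As [l] is odd, the valuation of [l - 1] is at least 1. The shift to [s.+1] thus leaves exactly
    [trunc_log 2 N] classes. *)
Lemma exceptional_sub (N : nat) (l : 'I_N.+1) : prime l -> (l == 1 %[mod 3])%N ->
  #|Kset l| = 0%N ->
  l \in \bigcup_(s < trunc_log 2 N) valuation_class N s.+1.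
Proof.
move=> l_pr l3 K0; have l1 := prime_gt1 l_pr.
have l_odd : odd l by case: (even_prime l_pr) => // l2; rewrite l2 in l3.
have l31 : (3 %| l.-1)%N by rewrite -subn1 -eqn_mod_dvd // ltnW.
have l10 : (0 < l.-1)%N by lia.
have le_l := prime_le_of_Kset_eq0 l_pr l_odd l31 K0.
have v1 : (0 < logn 2 l.-1)%N.
  by rewrite logn_gt0 mem_primes l10 dvdn2 /= -subn1 oddB ?l_odd // ltnW.
have vN : (logn 2 l.-1 <= trunc_log 2 N)%N.
  apply: trunc_log_max => //; apply: leq_trans (dvdn_leq l10 (pfactor_dvdnn 2 _)) _.
  by have := ltn_ord l; lia.
have lt : ((logn 2 l.-1).-1 < trunc_log 2 N)%N by rewrite prednK.
by apply/bigcupP; exists (Ordinal lt); rewrite // inE /= prednK // l1 eqxx.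
Qed.

Theorem theorem4 (R : realType) :
  exists C : R, 0 < C /\
    forall x : R, 2 <= x ->
      #|[set l : 'I_(Num.truncn x).+1 |
          [&& prime l, (l == 1 %[mod 3])%N, (l%:R <= x) & #|Kset l| == 0%N]]|%:R
        <= C * (x `^ (3 / 4)) * (ln x) ^+ 3.
Proof.
have ln2 : 0 < ln (2 : R) by rewrite ln_gt0 // ltr1n.
(* The number of classes is at most [ln x / ln 2]; the other two logarithms come from
   [1 <= ln x / ln 2]. *)
exists (12 / (ln 2) ^+ 3); split; first by rewrite divr_gt0 // exprn_gt0.
move=> x x2; set N := Num.truncn x; set E := [set l | _].
have x0 : 0 < x by apply: lt_le_trans x2.
have Nx : N%:R <= x by rewrite truncn_le // ltW.
have N0 : (0 < N)%N by rewrite truncn_gt0 (le_trans _ x2) // ler1n.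
pose T := trunc_log 2 N.
have cardE : (#|E| <= \sum_(s < T) #|valuation_class N s.+1|)%N.
  apply: leq_trans (card_bigcup_le _); apply/subset_leq_card/fintype.subsetP => l.
  by rewrite inE => /and4P[l_pr l3 _ /eqP K0]; apply: exceptional_sub.
have pow_ge0 : 0 <= x `^ (3 / 4) := powR_ge0 _ _.
have class_le s : #|valuation_class N s|%:R <= 12 * x `^ (3 / 4).
  rewrite -(@ler_pXn2r _ 4) ?nnegrE ?mulr_ge0 // exprMn.
  have -> : (x `^ (3 / 4)) ^+ 4 = x ^+ 3.
    rewrite -powR_mulrn // -powRrM -powR_mulrn ?ltW //; congr (_ `^ _); lra.
  have := card_valuation_class N s; rewrite -(ler_nat R) natrM !natrX.
  move/le_trans; apply; rewrite ler_pM2l ?exprn_gt0 //.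
  have xn : x \is Num.nneg by rewrite nnegrE ltW.
  by rewrite lerXn2r // nnegrE.
have T_le : T%:R * ln 2 <= ln x.
  rewrite mulr_natl -lnXn // ler_ln ?posrE ?exprn_gt0 //.
  by apply: le_trans Nx; rewrite -natrX ler_nat trunc_logP.
have E_le : #|E|%:R <= T%:R * (12 * x `^ (3 / 4)).
  apply: (@le_trans _ _ (\sum_(s < T) #|valuation_class N s.+1|)%N%:R).
    by rewrite ler_nat.
  rewrite natr_sum -[T in leRHS]card_ord mulr_natl -sumr_const.
  by apply: ler_sum => i _.
apply: le_trans E_le _.
have lnx : ln 2 <= ln x by rewrite ler_ln ?posrE.
rewrite -(ler_pM2r (exprn_gt0 3 ln2)).
have -> : 12 / ln 2 ^+ 3 * x `^ (3 / 4) * ln x ^+ 3 * ln 2 ^+ 3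
   = 12 * x `^ (3 / 4) * ln x ^+ 3 by field; rewrite gt_eqF.
rewrite [leLHS](_ : _ = 12 * x `^ (3 / 4) * (T%:R * ln 2 * (ln 2 * ln 2)));
  last by ring.
rewrite ler_wpM2l ?mulr_ge0 // exprS expr2.
have ln2_ge0 := ltW ln2; have lnx_ge0 := le_trans ln2_ge0 lnx.
by rewrite ler_pM ?mulr_ge0 // ler_pM.
Qed.
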